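(* Let $\epsilon_1\in(0,1]$ and let $p\ge1$ be an integer. Then there exists a $p$ times continuously differentiable function $f_p:\mathbb{R}\to\mathbb{R}$ such that the OFFAR$p$ algorithm applied to $f_p$ starting from the origin ($x_0=0$) takes exactly $$k_\epsilon=\left\lceil\epsilon_1^{-\frac{p+1}{p}}\right\rceil$$ iterations and derivative evaluations to produce an iterate $x_{k_\epsilon}$ such that $|\nabla_x^1f_p(x_{k_\epsilon})|\le\epsilon_1$.
   Context: Notation: $\|\cdot\|$ is the Euclidean norm on $\mathbb{R}^n$ (here $n=1$); $\nabla_x^i f(x)$ is the $i$th derivative tensor of $f$ at $x$, and $T[d]^i$ is the tensor $T$ applied to $i$ copies of $d$; $g_k=\nabla_x^1 f(x_k)$. The Taylor expansion is $T_{f,p}(x,s)=f(x)+\sum_{i=1}^p\frac{1}{i!}\nabla_x^i f(x)[s]^i$, $\nabla_s^1T_{f,p}$ is its gradient in $s$, and the regularized model is $m_k(s)=T_{f,p}(x_k,s)+\frac{\sigma_k}{(p+1)!}\|s\|^{p+1}$. OFFAR$p$ algorithm applied to $f$. Inputs: $x_0\in\mathbb{R}^n$, $\nu_0>0$, $\epsilon_1\in(0,1]$, $\theta_1>1$, $\vartheta\in(0,1]$. Set $k=0$. Step 1: evaluate $g_k$; terminate with $x_\epsilon=x_k$ if $\|g_k\|\le\epsilon_1$; else evaluate $\{\nabla_x^if(x_k)\}_{i=2}^p$. Step 2: if $k>0$, set $\mu_{1,k}=\frac{p!\,\|g_k\|}{\|s_{k-1}\|^p}-\theta_1\sigma_{k-1}$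 and select $\sigma_k\in[\vartheta\nu_k,\max(\nu_k,\mu_{1,k})]$; if $k=0$, set $\sigma_0=\mu_{1,0}=\nu_0$. Then compute a step $s_k$ with $m_k(s_k)-m_k(0)<0$ and $\|\nabla_s^1T_{f,p}(x_k,s_k)\|\le\theta_1\frac{\sigma_k}{p!}\|s_k\|^p$. Step 3: set $x_{k+1}=x_k+s_k$, $\nu_{k+1}=\nu_k+\nu_k\|s_k\|^{p+1}$, increment $k$ by one and return to Step 1. *)

(* Defs.v *)
From HB Require Import structures.
From mathcomp Require Import all_boot all_order all_algebra.
From mathcomp Require Import all_classical all_reals all_analysis.

Set Implicit Arguments.
Unset Strict Implicit.
Unset Printing Implicit Defensive.

Import Order.TTheory GRing.Theory Num.Theory.
Import numFieldNormedType.Exports.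

Local Open Scope classical_set_scope.
Local Open Scope ring_scope.

Definition continuously_differentiable (R : realType) (p : nat) (f : R -> R) :=
  (forall i, (i < p)%N -> forall x, derivable (derive1n i f) x 1) /\
  continuous (derive1n p f).

(* In dimension one the tensor application \nabla^i f(x)[s]^i is the product
   derive1n i f x * s ^+ i. *)
Definition taylor (R : realType) (f : R -> R) (p : nat) (x s : R) : R :=
  f x + \sum_(1 <= i < p.+1) (i`!%:R)^-1 * (derive1n i f x * s ^+ i).

Definition reg_model (R : realType) (f : R -> R) (p : nat) (x sigma s : R) : R :=
  taylor f p x s + sigma / (p.+1)`!%:R * `|s| ^+ p.+1.

Record offar_inputs (R : realType) := OffarInputs {
  start : R;
  nu_init : R;
  eps1 : R;
  theta1 : R;
  vartheta : R
}.

Record valid_inputs (R : realType) (I : offar_inputs R) : Prop := {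
  nu_init_gt0 : 0 < nu_init I;
  eps1_itv : 0 < eps1 I <= 1;
  theta1_gt1 : 1 < theta1 I;
  vartheta_itv : 0 < vartheta I <= 1
}.

(* The sequences generated by an execution. [evals k i] is the number of
   evaluations of the i-th derivative of f that have been made when Step 1 of
   iteration k is entered, i.e. at the moment x_k has been produced. *)
Record trajectory (R : realType) := Trajectory {
  iterate : nat -> R;
  step : nat -> R;
  sigma : nat -> R;
  nu : nat -> R;
  mu : nat -> R;
  evals : nat -> nat -> nat
}.

Record offar_init (R : realType) (I : offar_inputs R) (t : trajectory R)
    : Prop := {
  init_iterate : iterate t 0 = start I;
  init_nu : nu t 0 = nu_init I;
  init_evals : forall i, evals t 0 i = 0%N
}.

Definition terminates (R : realType) (f : R -> R) (I : offar_inputs R) (x : R) :=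
  `|derive1n 1 f x| <= eps1 I.

(* A full (non-terminating) pass through Steps 1-3. The choices of sigma_k and
   s_k are nondeterministic, so this is a relation on the trajectory. *)
Record offar_iteration (R : realType) (p : nat) (f : R -> R)
    (I : offar_inputs R) (t : trajectory R) (k : nat) : Prop := {
  step1_continue : ~ terminates f I (iterate t k);
  step1_evals : forall i, evals t k.+1 i = (evals t k i + (1 <= i <= p))%N;
  step2_sigma :
    match k with
    | 0 => sigma t k = nu_init I /\ mu t k = nu_init I
    | j.+1 =>
        mu t k = p`!%:R * `|derive1n 1 f (iterate t k)| / `|step t j| ^+ p
                 - theta1 I * sigma t j /\
        vartheta I * nu t k <= sigma t k <= Num.max (nu t k) (mu t k)
    end;
  step2_decrease :
    reg_model f p (iterate t k) (sigma t k) (step t k)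
    - reg_model f p (iterate t k) (sigma t k) 0 < 0;
  step2_gradient :
    `|derive1 (taylor f p (iterate t k)) (step t k)|
    <= theta1 I * (sigma t k / p`!%:R) * `|step t k| ^+ p;
  step3_iterate : iterate t k.+1 = iterate t k + step t k;
  step3_nu : nu t k.+1 = nu t k + nu t k * `|step t k| ^+ p.+1
}.

(* The execution makes exactly K iterations and then terminates at x_K; the
   values of the sequences beyond that point are irrelevant. *)
Record offar_run (R : realType) (p : nat) (f : R -> R) (I : offar_inputs R)
    (t : trajectory R) (K : nat) : Prop := {
  run_init : offar_init I t;
  run_iterations : forall k, (k < K)%N -> offar_iteration p f I t k;
  run_terminates : terminates f I (iterate t K)
}.

(* Main.v *)
(** With $\sigma_k = \nu_k$, a point where the derivatives of order 2 to $p$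
vanish and $f' = -c$ with $c > 0$ has a linear Taylor model with slope $-c$, and
the step $s_k = (p!\,c/\sigma_k)^{1/p}$ meets both conditions of Step 2, since
$1 < \theta_1$ and $1/(p+1) < 1$. For $c = 2\epsilon_1$ the regularizers and the
steps, hence the iterates, are thus determined before $f$ is known, and the
iterates increase strictly. It remains to interpolate: a polynomial $f$ exists
with $f' = -2\epsilon_1$ and vanishing derivatives of order 2 to $p$ at
$x_0, \dots, x_{k_\epsilon - 1}$, and $f' = 0$ at $x_{k_\epsilon}$. *)

Require Import Defs.
From HB Require Import structures.
From mathcomp Require Import all_boot all_order all_algebra.
From mathcomp Require Import all_classical all_reals all_analysis.
From mathcomp Require Import ring lra.

Set Implicit Arguments.
Unset Strict Implicit.
Unset Printing Implicit Defensive.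

Import Order.TTheory GRing.Theory Num.Theory.
Import numFieldNormedType.Exports.
Local Open Scope classical_set_scope.
Local Open Scope ring_scope.

Lemma antiderivative_poly (R : numFieldType) (q : {poly R}) :
  exists P : {poly R}, P^`() = q.
Proof.
(* At [i = 0] the quotient has denominator 0 and so equals 0 by convention; differentiation discards
   this constant term anyway. *)
exists (\poly_(i < (size q).+1) (q`_i.-1 / i%:R)).
apply/polyP => i; rewrite coef_deriv coef_poly ltnS -[LHS]mulr_natr.
have [isz|szi] := ltnP i (size q); first by rewrite /= divfK// pnatr_eq0.
by rewrite mul0r nth_default.
Qed.

(** Differentiating a multiple of $(X-a)^{n+1}$ leaves a multiple of $(X-a)^n$. The cofactor [r] is
    arbitrary, and generalized in the induction, because each derivative changes it. *)
Lemma root_derivn (R : comNzRingType) (a : R) (n : nat) (r : {poly R}) (i : nat) :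
  (i < n)%N -> (r * ('X - a%:P) ^+ n)^`(i).[a] = 0.
Proof.
elim: i n r => [|i IH] [|n]// r ltin.
  by rewrite derivn0 exprS mulrCA hornerM hornerXsubC subrr mul0r.
rewrite derivSn derivM deriv_exp derivXsubC mul1r /=.
have -> : r^`() * ('X - a%:P) ^+ n.+1 + r * (('X - a%:P) ^+ n *+ n.+1) =
    (r^`() * ('X - a%:P) + r *+ n.+1) * ('X - a%:P) ^+ n.
  by rewrite [RHS]mulrDl exprS mulrA mulrnAl mulrnAr.
exact: IH.
Qed.

(* $P' = a + \lambda \prod_{k < n} (X - x_k)^d$. *)
Lemma interpolation (R : numFieldType) (n d : nat) (x : nat -> R) (a b : R) :
  (0 < d)%N -> (forall k, (k < n)%N -> x n != x k) ->
  exists P : {poly R},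
    (forall k, (k < n)%N ->
       P^`().[x k] = a /\ forall i, (1 < i <= d)%N -> P^`(i).[x k] = 0) /\
    P^`().[x n] = b.
Proof.
move=> d0 xneq; pose w : {poly R} := \prod_(k < n) ('X - (x k)%:P) ^+ d.
(* This permits the choice $\lambda = (b-a)/w(x_n)$, which makes $P'(x_n) = b$. *)
have wn0 : w.[x n] != 0.
  rewrite horner_prod; apply/prodf_neq0 => k _.
  by rewrite !hornerE expf_neq0// subr_eq0 xneq.
have [P dP] := antiderivative_poly (a%:P + ((b - a) / w.[x n])%:P * w).
exists P; split => [k ltkn|]; last first.
  by rewrite dP !hornerE divfK// addrC subrK.
(* At each node, $P' - a$ has a zero of order at least $d$: its derivatives of order 0 to $d-1$
   vanish there, which settles the orders 1 to $d$ of $P$. *)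
have [r wr] : exists r, ((b - a) / w.[x n])%:P * w = r * ('X - (x k)%:P) ^+ d.
  rewrite [in X in _ * X]/w (bigD1 (Ordinal ltkn))//= [X in _ * X]mulrC mulrA.
  by eexists.
split=> [|[|[|i]]//= lid].
  rewrite dP hornerD hornerC wr.
  by rewrite -[X in _ + horner X _]derivn0 root_derivn// addr0.
rewrite -2!derivnS derivSn dP wr derivnD derivnC hornerD horner0 add0r.
exact: root_derivn.
Qed.

Lemma derive1n_horner (R : realFieldType) (P : {poly R}) (i : nat) :
  derive1n i (horner P) = horner P^`(i).
Proof. by elim: i => // i IH; rewrite derive1nS IH derivnS derivE. Qed.

Lemma continuously_differentiable_horner (R : realType) (p : nat)
    (P : {poly R}) : continuously_differentiable p (horner P).
Proof.
split=> [i _ x|]; rewrite derive1n_horner; first exact: derivable_horner.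
exact: continuous_horner.
Qed.

Lemma taylor_linear (R : realType) (f : R -> R) (p : nat) (x : R) :
  (0 < p)%N -> (forall i, (1 < i <= p)%N -> derive1n i f x = 0) ->
  taylor f p x = horner ((f x)%:P + (derive1n 1 f x)%:P * 'X).
Proof.
move=> p0 df0; apply/funext => s; rewrite /taylor big_ltn// big_nat big1 => [|i].
  by rewrite hornerD hornerM !hornerC hornerX factS fact0 muln1 invr1 mul1r expr1 addr0.
by move=> ?; rewrite df0// mul0r mulr0.
Qed.

(** By $\sigma s^p = p!\,c$ the regularization term is $cs/(p+1)$, so the model changes by $-cs +
    cs/(p+1) < 0$. The Taylor gradient has absolute value $c$, and the bound on it equals $\theta
    c$. *)
Lemma step2_linear (R : realType) (f : R -> R) (p : nat) (x sigma s c theta : R) :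
  (0 < p)%N -> 0 < c -> 0 < s -> 1 < theta ->
  sigma * s ^+ p = p`!%:R * c ->
  derive1n 1 f x = - c ->
  (forall i, (1 < i <= p)%N -> derive1n i f x = 0) ->
  reg_model f p x sigma s - reg_model f p x sigma 0 < 0 /\
  `|derive1 (taylor f p x) s| <= theta * (sigma / p`!%:R) * `|s| ^+ p.
Proof.
move=> p0 c0 s0 theta1 ss df df0.
have pf0 : p`!%:R != 0 :> R by rewrite pnatr_eq0 -lt0n fact_gt0.
split; last first.
  rewrite taylor_linear// df -derivE derivD derivM !derivC derivX mul0r !add0r mulr1 hornerC normrN !gtr0_norm//.
  have -> : theta * (sigma / p`!%:R) * s ^+ p = theta * c.
    by rewrite -mulrA [sigma / _ * _]mulrAC ss [_ * c]mulrC mulfK.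
  by rewrite ler_peMl ?ltW.
rewrite /reg_model taylor_linear// df !hornerD !hornerM !hornerC !hornerX normr0 expr0n/= gtr0_norm//.
have -> : sigma / p.+1`!%:R * s ^+ p.+1 = c * s / p.+1%:R.
  rewrite factS natrM exprSr invfM.
  have -> : sigma * (p.+1%:R^-1 * p`!%:R^-1) * (s ^+ p * s) =
    (sigma * s ^+ p) * (p`!%:R^-1 * (s / p.+1%:R)) by ring.
  by rewrite ss; field; rewrite pf0 addrC natr1 pnatr_eq0.
have cs0 : 0 < c * s by rewrite mulr_gt0.
have : c * s / p.+1%:R < c * s.
  by rewrite ltr_pdivrMr ?ltr0n// ltr_pMr// ltr1n ltnS.
rewrite !mulr0 !addr0 mulNr; move: (c * s / _) => u; lra.
Qed.

Section schedule.
Variables (R : realType) (p : nat) (nu0 c : R).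
Hypotheses (p_gt0 : (0 < p)%N) (nu0_gt0 : 0 < nu0) (c_gt0 : 0 < c).

Definition step_length (v : R) : R := (p`!%:R * c / v) `^ p%:R^-1.

Fixpoint regularizer (k : nat) : R :=
  if k is j.+1 then
    regularizer j + regularizer j * `|step_length (regularizer j)| ^+ p.+1
  else nu0.

Definition position (k : nat) : R :=
  \sum_(j < k) step_length (regularizer j).

Lemma regularizer_gt0 k : 0 < regularizer k.
Proof. by elim: k => //= k IH; rewrite ltr_wpDr// mulr_ge0// ltW. Qed.

Lemma step_length_gt0 v : 0 < v -> 0 < step_length v.
Proof. by move=> v0; rewrite powR_gt0// divr_gt0// mulr_gt0// ltr0n fact_gt0. Qed.

Lemma step_lengthX v : 0 < v -> v * step_length v ^+ p = p`!%:R * c.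
Proof.
move=> v0; rewrite /step_length -powR_mulrn ?powR_ge0// -powRrM.
rewrite mulVf ?pnatr_eq0 -?lt0n// powRr1; last by rewrite divr_ge0 ?mulr_ge0 ?ltW.
by rewrite mulrC divfK// gt_eqF.
Qed.

Lemma position_lt n k : (k < n)%N -> position k < position n.
Proof.
apply: (@homo_ltn _ position (fun a b => a < b)) => [y x z|j]; first exact: lt_trans.
by rewrite /position big_ord_recr/= ltrDl step_length_gt0// regularizer_gt0.
Qed.

End schedule.

Theorem theorem3p11 (R : realType) (p : nat) (I : offar_inputs R) :
  (1 <= p)%N -> valid_inputs I -> start I = 0 ->
  exists f : R -> R, continuously_differentiable p f /\
  exists (t : trajectory R) (k_eps : nat),
    [/\ k_eps%:Z = Num.ceil (eps1 I `^ (- (p.+1%:R / p%:R))),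
        offar_run p f I t k_eps,
        forall i, (1 <= i <= p)%N -> evals t k_eps i = k_eps
      & `|derive1n 1 f (iterate t k_eps)| <= eps1 I].
Proof.
move=> p0 [nu0 /andP[e0 _] theta_gt1 /andP[_ vartheta1]] start0.
pose c := 2 * eps1 I; have c0 : 0 < c by rewrite mulr_gt0.
pose K := `|Num.ceil (eps1 I `^ (- (p.+1%:R / p%:R)))|%N.
pose v := regularizer p (nu_init I) c; pose x := position p (nu_init I) c.
pose s k := step_length p c (v k).
have v0 k : 0 < v k by exact: regularizer_gt0.
have s0 k : 0 < s k by exact: step_length_gt0.
(* The nodes are the positions 0 to [K]; strict monotonicity separates the last one from all
   others. *)
have [P [Pk PK]] := @interpolation R K p x (- c) 0 p0
  (fun k ltkK => negbT (gt_eqF (position_lt p nu0 c0 ltkK))).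
pose g k := derive1n 1 (horner P) (x k).
pose m k := if k is j.+1 then
  p`!%:R * `|g k| / `|s j| ^+ p - theta1 I * v j else nu_init I.
(* The sequence [v] serves both as $\sigma$ and as $\nu$. Each iteration adds one evaluation of
   every derivative of order 1 to $p$. *)
pose t := Trajectory x s v v m (fun k i => (k * (1 <= i <= p))%N).
have tK : terminates (horner P) I (iterate t K).
  by rewrite /terminates derive1n_horner derivn1 PK normr0 ltW.
exists (horner P); split; first exact: continuously_differentiable_horner.
exists t, K; split => //; last by move=> i /= ->; rewrite muln1.
  (* The absolute value in [K] is harmless: a power is nonnegative, hence above $-1$, so its ceiling
     is nonnegative. *)
  by rewrite gez0_abs// ceil_ge0 (lt_le_trans (ltrN10 _))// powR_ge0.
split=> // [|k ltkK].
  by split=> //; rewrite /= /x /position big_ord0.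
have [dP dPi] := Pk _ ltkK.
have g1 : derive1n 1 (horner P) (x k) = - c by rewrite derive1n_horner.
have gi i : (1 < i <= p)%N -> derive1n i (horner P) (x k) = 0.
  by move=> ip; rewrite derive1n_horner dPi.
have [dec grad] := step2_linear p0 c0 (s0 k) theta_gt1
  (step_lengthX p0 c0 (v0 k)) g1 gi.
split=> //=.
(* Before [K] the gradient has absolute value $2\epsilon_1 > \epsilon_1$, so no earlier iterate
   stops the run. *)
- by rewrite /terminates [derive1n _ _ _]g1 normrN gtr0_norm// /c; apply/negP; rewrite -ltNge; lra.
- by move=> i; rewrite mulSn addnC.
- case: k {ltkK dP dPi g1 gi dec grad} => [//|j]; split=> //.
  (* The choice $\sigma_k = \nu_k$ is admissible whatever $\mu_{1,k}$ is: $\vartheta \le 1$ gives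
     the lower bound, the maximum the upper one. *)
  by rewrite le_max lexx ler_piMl// ltW.
- by rewrite /x /position big_ord_recr.
Qed.
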